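(* Let $n\ge 1$ and let $G=G_1\times\cdots\times G_n$ be a finitely generated group. Suppose that at least one of the following holds: (i) the set $D_{\mathbb{Q}}(G_1)$ is non-empty, finite, and contained in an open hemisphere of $S(G_1)$, and $D_{\mathbb{Q}}(G_j)$ is finite (possibly empty) for $2\le j\le n$; (ii) the set $L_{\mathbb{Q}}(G_1)$ is non-empty, finite, and contained in an open hemisphere of $S(G_1)$, and $L_{\mathbb{Q}}(G_j)$ is finite (possibly empty) for $2\le j\le n$; (iii) the set $L(G_1)\cap S_{\mathbb{Q}}(G_1)$ is non-empty, finite, and contained in an open hemisphere of $S(G_1)$, and $L(G_j)\cap S_{\mathbb{Q}}(G_j)$ is finite (possibly empty) for $2\le j\le n$. Then $G$ has the $R_\infty$-property.
   Context: For a group $\Gamma$ and an automorphism $\phi$ of $\Gamma$, two elements $x,y\in\Gamma$ are $\phi$-twisted conjugate if $y=\gamma x\phi(\gamma^{-1})$ for some $\gamma\in\Gamma$; $R(\phi)$ denotes the number of equivalence classes of this relation ($\infty$ if infinite). $\Gamma$ has the $R_\infty$-property if $R(\phi)=\infty$ for every $\phi\in\mathrm{Aut}(\Gamma)$. For a finitely generated group $\Gamma$, the character sphere is $S(\Gamma)=(\mathrm{Hom}(\Gamma,\mathbb{R})\setminus\{0\})/\mathbb{R}_{>0}$, where the positive reals act by scalar multiplication; it is given the quotient topology (a sphere of dimension $r-1$, where $r$ is the rank of $\Gamma^{\mathrm{ab}}$, empty if $r=0$), and the class of $\chi$ is denoted $[\chi]$. An open hemisphere of $S(\Gamma)$ is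 the image of an open half-space $\{\chi\in \mathrm{Hom}(\Gamma,\mathbb{R}): \ell(\chi)>0\}$ for a non-zero linear functional $\ell$ on $\mathrm{Hom}(\Gamma,\mathbb{R})$. $\Sigma(\Gamma)=\Sigma^1(\Gamma)\subset S(\Gamma)$ is the Bieri–Neumann–Strebel invariant, an open subset: $[\chi]\in\Sigma(\Gamma)$ if and only if the full subgraph of the Cayley graph of $\Gamma$ (with respect to a finite generating set, with edges joining $g$ to $gs$, $s$ a generator) spanned by the vertices $g$ with $\chi(g)\ge 0$ is connected. $\Sigma^c(\Gamma)=S(\Gamma)\setminus\Sigma(\Gamma)$ denotes its complement. A class $[\chi]\in S(\Gamma)$ is rational (or discrete) if the image of $\chi$ in $\mathbb{R}$ is infinite cyclic. $S_{\mathbb{Q}}(\Gamma)$ is the set of rational points of $S(\Gamma)$. $D_{\mathbb{Q}}(\Gamma)$ is the set of rational points that are isolated points of $\Sigma^c(\Gamma)$. $L_{\mathbb{Q}}(\Gamma)$ is the set of all limit points of $D_{\mathbb{Q}}(\Gamma)$ that lie in $S_{\mathbb{Q}}(\Gamma)$. $L(\Gamma)$ is the set of all limit points of $\Sigma^c(\Gamma)$. *)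

(* Defs.v *)
From HB Require Import structures.
From mathcomp Require Import all_boot all_order all_algebra.
From mathcomp Require Import all_classical all_reals all_analysis.

Set Implicit Arguments.
Unset Strict Implicit.
Unset Printing Implicit Defensive.

Import Order.TTheory GRing.Theory Num.Theory.
Import numFieldNormedType.Exports.

Local Open Scope classical_set_scope.
Local Open Scope quotient_scope.
Local Open Scope ring_scope.

Section ProductGroup.
Context {I : Type} (G : I -> groupType).

Definition prod_group : Type := forall i, G i.

HB.instance Definition _ := Choice.copy prod_group (forall i, G i).

Definition prodg_one : prod_group := fun i => 1%g.
Definition prodg_inv (x : prod_group) : prod_group := fun i => (x i)^-1%g.
Definition prodg_mul (x y : prod_group) : prod_group :=
  fun i => (x i * y i)%g.

Fact prodg_mulA : associative prodg_mul.
Proof. by move=> x y z; apply: functional_extensionality_dep => i; exact: mulgA. Qed.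
Fact prodg_mul1g : left_id prodg_one prodg_mul.
Proof. by move=> x; apply: functional_extensionality_dep => i; exact: mul1g. Qed.
Fact prodg_mulg1 : right_id prodg_one prodg_mul.
Proof. by move=> x; apply: functional_extensionality_dep => i; exact: mulg1. Qed.
Fact prodg_mulVg : left_inverse prodg_one prodg_inv prodg_mul.
Proof. by move=> x; apply: functional_extensionality_dep => i; exact: mulVg. Qed.
Fact prodg_mulgV : right_inverse prodg_one prodg_inv prodg_mul.
Proof. by move=> x; apply: functional_extensionality_dep => i; exact: mulgV. Qed.

HB.instance Definition _ := isGroup.Build prod_group
  prodg_mulA prodg_mul1g prodg_mulg1 prodg_mulVg prodg_mulgV.

End ProductGroup.

Definition generates (Gamma : groupType) (X : seq Gamma) : Prop :=
  forall H : {pred Gamma}, group_closed H -> {subset X <= H} ->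
  forall g, g \in H.

Definition finitely_generated (Gamma : groupType) : Prop :=
  exists X : seq Gamma, generates X.

Section TwistedConjugacy.
Variables (Gamma : groupType) (phi : {multiplicative Gamma -> Gamma}).

Definition twisted_conjugate (x y : Gamma) : Prop :=
  exists g : Gamma, y = (g * x * phi g^-1)%g.

Definition twisted_classes : set (set Gamma) :=
  range (fun x => [set y | twisted_conjugate x y]).

End TwistedConjugacy.

Definition R_infinity (Gamma : groupType) : Prop :=
  forall phi : {multiplicative Gamma -> Gamma}, bijective phi ->
    infinite_set (twisted_classes phi).

Section CharacterSphere.
Variables (R : realType) (Gamma : groupType).

Definition is_character : {pred Gamma -> R^o} :=
  [pred chi : Gamma -> R^o |
    `[< forall g h : Gamma, chi (g * h)%g = chi g + chi h >]].

Fact is_character_submod_closed : submod_closed is_character.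
Proof.
split; first by apply/asboolP => g h; rewrite [RHS]addr0.
move=> a chi psi /asboolP chiM /asboolP psiM.
by apply/asboolP => g h; rewrite !fctE chiM psiM /= scalerDr addrACA.
Qed.

HB.instance Definition _ := GRing.isSubmodClosed.Build R (Gamma -> R^o)
  is_character is_character_submod_closed.

Record character := Character {
  char_fun :> Gamma -> R^o;
  char_funP : char_fun \in is_character }.

HB.instance Definition _ := [isSub for char_fun].
HB.instance Definition _ := [Choice of character by <:].
HB.instance Definition _ := [SubChoice_isSubLmodule of character by <:].

(* Pointwise convergence: when Gamma is finitely generated this is the usual
   topology of the finite-dimensional real vector space Hom(Gamma, R). *)
HB.instance Definition _ := Topological.copy character
  (initial_topology (char_fun : character -> {ptws Gamma -> R})).

Definition nz_character : Type := {chi : character | chi != 0}.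

HB.instance Definition _ := Choice.on nz_character.
HB.instance Definition _ := Topological.copy nz_character
  (initial_topology (val : nz_character -> character)).

Definition same_ray : rel nz_character := [rel chi psi |
  `[< exists2 r : R, 0 < r & val psi = r *: val chi >]].

Fact same_ray_equiv : equiv_class_of same_ray.
Proof.
split=> [chi|chi psi|psi chi xi].
- by apply/asboolP; exists 1; rewrite ?ltr01 ?scale1r.
- apply/asboolP/asboolP => -[r r0 e]; exists r^-1; rewrite ?invr_gt0 //.
    by rewrite e scalerA mulVf ?gt_eqF // scale1r.
  by rewrite e scalerA mulVf ?gt_eqF // scale1r.
- move=> /asboolP[r r0 e] /asboolP[s s0 f]; apply/asboolP; exists (s * r).
    exact: mulr_gt0.
  by rewrite f e scalerA.
Qed.

Canonical same_ray_equivRel := EquivRelPack same_ray_equiv.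

Definition char_sphere := quotient_topology {eq_quot same_ray}.

Definition ray (chi : nz_character) : char_sphere := \pi_char_sphere chi.

Definition open_hemisphere (H : set char_sphere) : Prop :=
  exists2 l : {linear character -> R^o}, (exists chi, l chi != 0) &
    H = [set ray chi | chi in [set chi : nz_character | 0 < l (val chi)]].

Definition in_open_hemisphere (A : set char_sphere) : Prop :=
  exists2 H, open_hemisphere H & A `<=` H.

Definition cayley_edge (X : seq Gamma) : rel Gamma :=
  [rel g h | has (fun s => (h == g * s)%g || (g == h * s)%g) X].

Definition half_space_connected (X : seq Gamma) (chi : Gamma -> R) : Prop :=
  forall g h, 0 <= chi g -> 0 <= chi h ->
  exists p : seq Gamma, [/\ path (cayley_edge X) g p, last g p = h &
                            all (fun x => 0 <= chi x) p].

(* Half-space connectedness does not depend on the finite generating set X, so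
   quantifying X existentially agrees with fixing one. *)
Definition BNS_Sigma : set char_sphere :=
  [set ray chi | chi in [set chi : nz_character |
    exists2 X : seq Gamma, generates X & half_space_connected X (val chi)]].

Definition Sigma_c : set char_sphere := ~` BNS_Sigma.

(* Infinite cyclic subgroups of R are the a Z with a != 0. *)
Definition discrete_char (chi : Gamma -> R) : Prop :=
  exists2 a : R, a != 0 & range chi = range (fun m : int => a *~ m).

Definition S_Q : set char_sphere :=
  [set ray chi | chi in [set chi : nz_character | discrete_char (val chi)]].

Definition D_Q : set char_sphere := S_Q `&` isolated Sigma_c.

Definition L_Q : set char_sphere := limit_point D_Q `&` S_Q.

Definition L_Sigma_c : set char_sphere := limit_point Sigma_c.

End CharacterSphere.

Arguments in_open_hemisphere {R Gamma} A.
Arguments BNS_Sigma R Gamma : clear implicits.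
Arguments Sigma_c R Gamma : clear implicits.
Arguments S_Q R Gamma : clear implicits.
Arguments D_Q R Gamma : clear implicits.
Arguments L_Q R Gamma : clear implicits.
Arguments L_Sigma_c R Gamma : clear implicits.

(* Main.v *)
(** If an automorphism [phi] fixes a non-zero character [chi], then [chi] is
    constant on [phi]-twisted conjugacy classes, so R(phi) is infinite.  To find
    such a [chi], let K be D_Q, L_Q or the set of rational limit points of
    Sigma^c; any automorphism of [G] permutes K(G).  A character that is
    non-zero on two factors lies in Sigma(G), so Sigma^c(G) is the union of the
    Sigma^c(G_j).  The spheres S(G_j) embed in S(G) as disjoint closed subsets,
    so K(G) is also the disjoint union of the K(G_j), hence finite.  Each of its
    points has a unique representative with image Z; the sum of these
    representatives is invariant under every automorphism, and it does not
    vanish because its restriction to G_1 is the sum over K(G_1), all of whose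
    terms lie in one open half-space. *)

From HB Require Import structures.
Require Import Defs.
From mathcomp Require Import all_boot all_order all_algebra.
From mathcomp Require Import all_classical all_reals all_analysis.

Set Implicit Arguments.
Unset Strict Implicit.
Unset Printing Implicit Defensive.

Import Order.TTheory GRing.Theory Num.Theory.
Import numFieldNormedType.Exports.

Local Open Scope classical_set_scope.
Local Open Scope quotient_scope.
Local Open Scope ring_scope.

(** * Characters and half-spaces *)

Section Characters.
Context {R : realType} {Gamma : groupType}.
Implicit Types (chi psi : character R Gamma) (g h : Gamma).

Lemma charM chi g h : chi (g * h)%g = chi g + chi h.
Proof. by have /asboolP := char_funP chi; apply. Qed.

Lemma char1 chi : chi 1%g = 0.
Proof. by apply: (@addrI _ (chi 1%g)); rewrite -charM mulg1 addr0. Qed.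

Lemma charV chi g : chi g^-1%g = - chi g.
Proof. by apply/eqP; rewrite -addr_eq0 -charM mulVg char1. Qed.

Lemma charX chi g n : chi (g ^+ n)%g = chi g *+ n.
Proof.
elim: n => [|n IHn]; first by rewrite expg0 char1.
by rewrite expgS charM IHn mulrS.
Qed.

Lemma char_ext chi psi : chi =1 psi -> chi = psi.
Proof. by move=> e; apply/val_inj/funext. Qed.

(** A negative value at [g] becomes a positive one at the inverse of [g]. *)
Lemma char_neq0P chi : reflect (exists g, 0 < chi g) (chi != 0).
Proof.
apply: (iffP idP) => [chi0|[g]]; last first.
  by apply: contraTneq => ->; rewrite ltxx.
apply: contrapT => /forallNP chi_le0; move/eqP: chi0; apply.
apply: char_ext => g; apply/eqP; rewrite eq_le; apply/andP; split.
  by rewrite leNgt; apply/negP/chi_le0.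
by rewrite -oppr_le0 -charV leNgt; apply/negP/chi_le0.
Qed.

End Characters.

(** Subgroup induction: [P] is made a boolean predicate classically, so that [generates] applies to
    it. *)
Lemma generates_ind (Gamma : groupType) (X : seq Gamma) (P : Gamma -> Prop) :
  generates X -> P 1%g -> (forall g h, P g -> P h -> P (g * h)%g) ->
  (forall g, P g -> P g^-1%g) -> (forall x, x \in X -> P x) -> forall g, P g.
Proof.
move=> gX P1 PM PV PX g; apply/asboolP.
apply: (gX [pred h | `[< P h >]]) => [|x xX]; last by apply/asboolP/PX.
split=> [|h k /asboolP Ph /asboolP Pk]; first exact/asboolP.
by apply/asboolP/PM => //; apply: PV.
Qed.

Section HalfSpace.
Context {R : realType} {Gamma : groupType}.
Variables (X : seq Gamma) (chi : character R Gamma).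

(** [path] does not list its starting vertex, so [0 <= chi g] is recorded separately; this makes the
    relation symmetric. *)
Definition linked (g h : Gamma) : Prop := 0 <= chi g /\
  exists p : seq Gamma, [/\ path (cayley_edge X) g p, last g p = h &
                            all (fun x => 0 <= chi x) p].

Lemma linked_refl g : 0 <= chi g -> linked g g.
Proof. by move=> g0; split=> //; exists [::]. Qed.

Lemma linked_trans h g k : linked g h -> linked h k -> linked g k.
Proof.
move=> [g0 [p [pp <- p0]]] [_ [q [pq <- q0]]]; split=> //; exists (p ++ q).
by rewrite cat_path pp pq last_cat all_cat p0 q0.
Qed.

Lemma linked_sym g h : linked g h -> linked h g.
Proof.
move=> [g0 [p [pp <- p0]]].
have gp0 : all (fun x => 0 <= chi x) (g :: p) by rewrite /= g0.
split; first exact: (allP gp0) (mem_last _ _).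
exists (rev (belast g p)); split.
- rewrite rev_path; apply: sub_path pp => x y /hasP[s sX /orP e].
  by apply/hasP; exists s => //; apply/orP; case: e; [right|left].
- by case: p {pp p0 gp0} => //= x p; rewrite rev_cons last_rcons.
- apply/allP => x; rewrite mem_rev => /mem_belast; exact: (allP gp0).
Qed.

Lemma linked_step x g : x \in X -> 0 <= chi g -> 0 <= chi (g * x)%g ->
  linked g (g * x)%g.
Proof.
move=> xX g0 gx0; split=> //; exists [:: (g * x)%g]; split=> //=.
  by rewrite andbT; apply/hasP; exists x; rewrite ?eqxx.
by rewrite gx0.
Qed.

Lemma linked_up x n g : x \in X -> 0 <= chi x -> 0 <= chi g ->
  linked g (g * x ^+ n)%g.
Proof.
move=> xX x0 g0; elim: n => [|n IHn].
  by rewrite expg0 mulg1; apply: linked_refl.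
have gx0 m : 0 <= chi (g * x ^+ m)%g.
  by rewrite charM charX addr_ge0 ?mulrn_wge0.
apply: linked_trans IHn _; rewrite expgSr mulgA; apply: linked_step => //.
by rewrite -mulgA -expgSr.
Qed.

Lemma linked1_connected : (forall g, 0 <= chi g -> linked 1%g g) ->
  half_space_connected X chi.
Proof.
move=> l1 g h g0 h0.
by have [] := linked_trans (linked_sym (l1 g g0)) (l1 h h0).
Qed.

Lemma large_power_ge0 g x : 0 < chi x ->
  exists N, forall n, (N <= n)%N -> 0 <= chi (g * x ^+ n)%g.
Proof.
move=> x0; exists (Num.bound `|- chi g / chi x|) => n leNn.
rewrite charM charX -lerBlDl sub0r -mulr_natl -ler_pdivrMr //.
apply: le_trans (ler_norm _) _; apply: ltW.
by apply: lt_le_trans (archi_boundP (normr_ge0 _)) _; rewrite ler_nat.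
Qed.

(* Far enough up, [g] and [g * x] can be joined after translating by powers of
   whichever of [t], [s] commutes with [x]; switching between the two translates
   is free because [t] and [s] commute. *)
Lemma commuting_half_space_connected t s :
  generates X -> t \in X -> s \in X -> commute t s -> 0 < chi t -> 0 < chi s ->
  {in X, forall x, commute x t \/ commute x s} -> half_space_connected X chi.
Proof.
move=> gX tX sX cts t0 s0 cX.
have swap g m n : 0 <= chi (g * t ^+ m)%g -> 0 <= chi (g * s ^+ n)%g ->
    linked (g * t ^+ m) (g * s ^+ n).
  move=> gt0 gs0; apply: (@linked_trans (g * t ^+ m * s ^+ n)%g).
    by apply: linked_up => //; exact: ltW.
  rewrite -mulgA (commuteX2 m n cts) mulgA; apply: linked_sym.
  by apply: linked_up => //; exact: ltW.
have push g m k : (m <= k)%N -> 0 <= chi (g * t ^+ m)%g ->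
    linked (g * t ^+ m) (g * t ^+ k).
  move=> mk gt0; rewrite -(subnKC mk) expgnDr mulgA.
  by apply: linked_up => //; exact: ltW.
(* Induction on [h] with [g] and [m] free: the base point changes in the product and inverse cases,
   the exponent in the product case. *)
have move_right : forall h g m, 0 <= chi (g * t ^+ m)%g ->
    0 <= chi (g * h * t ^+ m)%g -> linked (g * t ^+ m) (g * h * t ^+ m).
  apply: (generates_ind gX) => [|h k IHh IHk|h IHh|x xX] g m.
  - by rewrite mulg1 => gt0 _; apply: linked_refl.
  (* The intermediate vertex [g * h * t ^+ m] may leave the half-space, so all three vertices are
     first raised to a common larger exponent. *)
  - move=> gt0 ghk0; have [N /(_ (maxn m N) (leq_maxr _ _)) gh0] :=
      large_power_ge0 (g * h)%g t0.
    have mN : (m <= maxn m N)%N := leq_maxl _ _.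
    have l0 := push _ _ _ mN gt0; have l1 := push _ _ _ mN ghk0.
    apply: (linked_trans l0); apply: (linked_trans _ (linked_sym l1)).
    apply: (@linked_trans (g * h * t ^+ maxn m N)%g).
      by apply: IHh => //; have [] := linked_sym l0.
    rewrite mulgA; apply: IHk => //; rewrite -[(g * h * k)%g]mulgA.
    by have [] := linked_sym l1.
  - move=> gt0 gh0; apply: linked_sym.
    by have := IHh (g * h^-1)%g m; rewrite mulgVK; apply.
  - move=> gt0 gx0; have [cxt|cxs] := cX x xX.
      rewrite -mulgA (commuteX m cxt) mulgA in gx0 *.
      exact: linked_step.
    have [N1 hN1] := large_power_ge0 g s0.
    have [N2 hN2] := large_power_ge0 (g * x)%g s0.
    have {hN1} g1 := hN1 (maxn N1 N2) (leq_maxl _ _).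
    have {hN2} g2 := hN2 (maxn N1 N2) (leq_maxr _ _).
    apply: linked_trans (swap _ _ _ gt0 g1) _.
    apply: linked_trans (linked_sym (swap _ _ _ gx0 g2)).
    rewrite -mulgA (commuteX _ cxs) mulgA in g2 *.
    exact: linked_step.
apply: linked1_connected => g g0.
have := move_right g 1%g 0%N; rewrite expg0 !mulg1 mul1g; apply=> //.
by rewrite char1.
Qed.

End HalfSpace.

(** * Pullback of characters along retractions *)

Section GroupMorphism.
Context {G H : groupType} (f : {multiplicative G -> H}).

Lemma multiplicative1 : f 1%g = 1%g.
Proof. by apply: (@mulgI _ (f 1%g)); rewrite -gmulfM !mulg1. Qed.

Lemma multiplicativeV g : f g^-1%g = (f g)^-1%g.
Proof. by apply: (@mulgI _ (f g)); rewrite -gmulfM !mulgV multiplicative1. Qed.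

End GroupMorphism.

Section Pullback.
Context {R : realType} {Gamma Delta : groupType}.
Variable p : {multiplicative Gamma -> Delta}.
Implicit Types chi psi : character R Delta.

Fact pull_subproof chi : (chi \o p : Gamma -> R^o) \in @is_character R Gamma.
Proof. by apply/asboolP => g h; rewrite /= gmulfM charM. Qed.

Definition pull chi : character R Gamma := Character (pull_subproof chi).

Fact pull_is_linear : linear pull.
Proof. by move=> a chi psi; exact: char_ext. Qed.

HB.instance Definition _ := GRing.isLinear.Build R (character R Delta)
  (character R Gamma) *:%R pull pull_is_linear.

End Pullback.

(** A split surjection. Projections of a direct product onto its factors and automorphisms are both
    of this kind, so one treatment of pullbacks serves both. *)
Record retraction (Gamma Delta : groupType) := Retraction {
  rproj :> {multiplicative Gamma -> Delta};
  rsec : {multiplicative Delta -> Gamma};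
  rsecK : cancel rsec rproj }.

(** * Rays, Sigma and rational points *)

Section Rays.
Context {R : realType} {Gamma : groupType}.
Implicit Types (chi psi : nz_character R Gamma) (x : char_sphere R Gamma).

Lemma ray_eqP chi psi :
  ray chi = ray psi <-> exists2 r : R, 0 < r & val psi = r *: val chi.
Proof.
by split=> [/eqmodP/asboolP|e] //; apply/eqmodP/asboolP.
Qed.

Lemma ray_surj x : exists chi, x = ray chi.
Proof. by exists (repr x); rewrite /ray reprK. Qed.

(** Positive scaling does not change the set where a character is non-negative, so any
    representative of the ray may be tested. *)
Lemma BNS_Sigma_ray chi : BNS_Sigma R Gamma (ray chi) <->
  exists2 X, generates X & half_space_connected X (val chi).
Proof.
split=> [[psi [X gX hX] /ray_eqP[r r0 e]]|]; last by exists chi.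
have chi_ge0 g : (0 <= val chi g) = (0 <= val psi g).
  by rewrite e /= pmulr_rge0.
exists X => // g h; rewrite !chi_ge0 => g0 h0.
have [q [pq lq q0]] := hX g h g0 h0; exists q; split=> //.
by rewrite (eq_all chi_ge0).
Qed.

Lemma S_Q_ray chi : S_Q R Gamma (ray chi) <-> discrete_char (val chi).
Proof.
split=> [[psi [a a0 e] /ray_eqP[r r0 e']]|]; last by exists chi.
exists (r * a); first by rewrite mulf_neq0 // gt_eqF.
rewrite e'; apply/seteqP; split=> [_ [g _ <-]|_ [m _ <-]].
  have [m _ em] : range (fun m : int => a *~ m) (val psi g).
    by rewrite -e; exists g.
  by exists m => //; rewrite -[RHS]/(r * val psi g) -em mulrzAr.
have [g _ eg] : range (val psi) (a *~ m) by rewrite e; exists m.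
by exists g => //; rewrite -[LHS]/(r * val psi g) eg mulrzAr.
Qed.

End Rays.

(** The map [r] is onto, sends generators to generators and edges to edges, and respects the
    half-spaces. A path between the lifts [rsec r c] and [rsec r d] is therefore pushed down to one
    between [c] and [d]. *)
Lemma retract_Sigma (R : realType) (Gamma Delta : groupType)
    (r : retraction Gamma Delta) (chi : nz_character R Gamma)
    (psi : nz_character R Delta) :
  val chi = pull r (val psi) ->
  BNS_Sigma R Gamma (ray chi) -> BNS_Sigma R Delta (ray psi).
Proof.
move=> e /BNS_Sigma_ray[X gX hX]; apply/BNS_Sigma_ray.
have chiE g : val chi g = val psi (r g) by rewrite e.
exists (map r X) => [H [H1 HV] HX d|c d c0 d0].
  rewrite -(rsecK r d); move: (rsec r d).
  apply: (generates_ind (P := fun g => r g \in H) gX) => [|g h Hg Hh|g Hg|x xX].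
  - by rewrite multiplicative1.
  - by rewrite gmulfM; apply: group_closedM.
  - by rewrite multiplicativeV; apply: group_closedV.
  - exact/HX/map_f.
have := hX (rsec r c) (rsec r d).
rewrite !chiE !rsecK => /(_ c0 d0)[q [pq lq q0]].
exists (map r q); split.
- rewrite -[c](rsecK r) path_map; apply: sub_path pq => g h /hasP[x xX e'].
  apply/hasP; exists (r x); first exact: map_f.
  by case/orP: e' => /eqP ->; rewrite gmulfM eqxx ?orbT.
- by rewrite -[c](rsecK r) last_map lq rsecK.
- by rewrite all_map; apply: sub_all q0 => g; rewrite /= chiE.
Qed.

Section RayPullback.
Context {R : realType} {Gamma Delta : groupType}.
Variable r : retraction Gamma Delta.

Lemma pull_rsecK (psi : character R Delta) : pull (rsec r) (pull r psi) = psi.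
Proof. by apply: char_ext => d; rewrite /= rsecK. Qed.

Lemma pull_neq0 (psi : nz_character R Delta) : pull r (val psi) != 0.
Proof.
apply: contraNneq (valP psi) => e.
by rewrite -[val psi]pull_rsecK e raddf0.
Qed.

Definition pull_nz (psi : nz_character R Delta) : nz_character R Gamma :=
  exist _ (pull r (val psi)) (pull_neq0 psi).

(** Defined through a chosen representative; [pull_rayE] shows that the choice does not matter. *)
Definition pull_ray (x : char_sphere R Delta) : char_sphere R Gamma :=
  ray (pull_nz (repr x)).

Lemma pull_rayE psi : pull_ray (ray psi) = ray (pull_nz psi).
Proof.
have /ray_eqP[a a0 e] : ray psi = ray (repr (ray psi)) by rewrite {2}/ray reprK.
by apply/esym/ray_eqP; exists a => //=; rewrite e linearZ.
Qed.

Lemma pull_ray_inj : injective pull_ray.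
Proof.
move=> x y; have [[phi ->] [psi ->]] := (ray_surj x, ray_surj y).
rewrite !pull_rayE => /ray_eqP[a a0 e]; apply/ray_eqP; exists a => //.
rewrite -[val psi]pull_rsecK -[pull r _]/(val (pull_nz psi)) e.
by rewrite linearZ /= pull_rsecK.
Qed.

Lemma pull_ray_Sigma x :
  BNS_Sigma R Gamma (pull_ray x) -> BNS_Sigma R Delta x.
Proof.
by have [psi ->] := ray_surj x; rewrite pull_rayE; apply: retract_Sigma.
Qed.

Lemma discrete_pull (psi : character R Delta) :
  discrete_char (pull r psi) <-> discrete_char psi.
Proof.
suff e : range (pull r psi) = range psi by rewrite /discrete_char e.
apply/seteqP; split=> [_ [g _ <-]|_ [d _ <-]]; first by exists (r g).
by exists (rsec r d) => //=; rewrite rsecK.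
Qed.

Lemma pull_ray_S_Q x : S_Q R Gamma (pull_ray x) <-> S_Q R Delta x.
Proof.
have [psi ->] := ray_surj x; rewrite pull_rayE.
rewrite (propext (S_Q_ray _)) (propext (S_Q_ray _)); exact: discrete_pull.
Qed.

End RayPullback.

(** * Topology of the character sphere *)

Section Topology.
Context {R : realType} {Gamma : groupType}.

Lemma char_eval_continuous (g : Gamma) :
  continuous (fun chi : character R Gamma => chi g : R).
Proof.
pose F : character R Gamma -> {ptws Gamma -> R} := @char_fun R Gamma.
have cF : continuous F by exact: initial_continuous.
have cg : continuous (fun f : {ptws Gamma -> R} => f g).
  exact: proj_continuous.
by move=> chi; exact: (continuous_comp (cF chi) (cg (F chi))).
Qed.

Lemma continuous_to_char (T : topologicalType) (f : T -> character R Gamma) :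
  (forall g, continuous (fun x => f x g : R)) -> continuous f.
Proof.
move=> cf; apply: continuous_comp_initial => x; apply/cvg_sup => g.
move: x; apply: continuous_comp_initial; exact: cf.
Qed.

Lemma nz_val_continuous :
  continuous (val : nz_character R Gamma -> character R Gamma).
Proof. exact: initial_continuous. Qed.

Lemma open_sphere (U : set (char_sphere R Gamma)) :
  open U = open (@ray R Gamma @^-1` U).
Proof. by []. Qed.

Lemma ray_continuous : continuous (@ray R Gamma).
Proof. exact: pi_continuous. Qed.

End Topology.

Lemma pull_continuous (R : realType) (Gamma Delta : groupType)
    (p : {multiplicative Gamma -> Delta}) :
  continuous (pull p : character R Delta -> character R Gamma).
Proof. apply: continuous_to_char => g; exact: char_eval_continuous. Qed.

Lemma open_char_neq0 (R : realType) (Gamma : groupType) :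
  open [set chi : character R Gamma | chi != 0].
Proof.
have -> : [set chi : character R Gamma | chi != 0] =
    \bigcup_g (fun chi : character R Gamma => chi g : R) @^-1` [set x | 0 < x].
  apply/seteqP; split=> [chi /= /char_neq0P[g g0]|chi [g _ g0]].
    by exists g.
  by apply/char_neq0P; exists g.
apply: bigcup_open => g _; apply: open_comp; last exact: open_gt.
by move=> chi _; exact: char_eval_continuous.
Qed.

Section RayPullbackTopology.
Context {R : realType} {Gamma Delta : groupType}.
Variable r : retraction Gamma Delta.

Lemma pull_ray_continuous :
  continuous (pull_ray r : char_sphere R Delta -> char_sphere R Gamma).
Proof.
apply/quotient_continuous.
rewrite (_ : _ \o _ = @ray R Gamma \o pull_nz r); last first.
  by apply/funext => psi; exact: pull_rayE.
move=> psi; apply: continuous_comp; last exact: ray_continuous.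
apply: continuous_comp_initial => {}psi.
exact: (continuous_comp (@nz_val_continuous R Delta psi)
  (@pull_continuous R _ _ r (val psi))).
Qed.

(** The preimage of [V] under restriction along [rsec r]. On spheres this restriction is only
    partial, since a non-zero character may restrict to 0; such rays are left out. *)
Definition section_preimage (V : set (char_sphere R Delta)) :
    set (char_sphere R Gamma) :=
  [set ray chi | chi in [set chi : nz_character R Gamma |
    exists2 psi, pull (rsec r) (val chi) = val psi & V (ray psi)]].

Lemma section_preimage_ray V chi : section_preimage V (ray chi) <->
  exists2 psi, pull (rsec r) (val chi) = val psi & V (ray psi).
Proof.
split=> [[xi [psi e Vpsi] /ray_eqP[a a0 e']]|]; last by exists chi.
have apsi0 : a *: val psi != 0 by rewrite scaler_eq0 negb_or gt_eqF ?(valP psi).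
exists (exist _ (a *: val psi) apsi0); first by rewrite e' linearZ /= e.
suff <- : ray psi = ray (exist _ (a *: val psi) apsi0) by [].
by apply/ray_eqP; exists a.
Qed.

(** The cone over [V] is the trace of an open [W] on the non-zero characters. As non-vanishing is
    itself an open condition, the preimage is open by continuity of restriction on the whole
    character space. *)
Lemma open_section_preimage V : open V -> open (section_preimage V).
Proof.
rewrite open_sphere => -[W oW WE]; rewrite open_sphere.
have -> : @ray R Gamma @^-1` section_preimage V =
    val @^-1` (pull (rsec r) @^-1` (W `&` [set chi | chi != 0])).
  apply/seteqP.
  split=> [chi /section_preimage_ray[psi e Vpsi]|chi /= [Wchi chi0]].
    rewrite /= e; split; last exact: (valP psi).
    by rewrite -[W _]/((val @^-1` W) psi) WE.
  apply/section_preimage_ray.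
  exists (exist (fun c : character R Delta => c != 0) _ chi0) => //.
  by rewrite -[V _]/((@ray R Delta @^-1` V) _) -WE.
apply: open_comp => [chi _|]; first exact: nz_val_continuous.
apply: open_comp => [chi _|]; first exact: pull_continuous.
apply: openI => //; exact: open_char_neq0.
Qed.

End RayPullbackTopology.

(** * Decompositions of the complement of Sigma *)

(** The closure of [A] is the disjoint union of its isolated points and its limit points. *)
Lemma isolatedE (X : topologicalType) (A : set X) x :
  isolated A x <-> A x /\ ~ limit_point A x.
Proof.
split=> [iA|[Ax]].
  split; first exact: isolatedS iA.
  have /disj_setPS dA := @disjoint_isolated_limit_point X A.
  by move=> lA; apply: (dA x).
have : closure A x by exact: subset_closure.
by rewrite closure_isolated_limit_point => -[].
Qed.

Section SumEmbedding.
Context {I : Type} {T : I -> topologicalType} {S : topologicalType}.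
Variable f : forall j, T j -> S.
Arguments f : clear implicits.

(* The map from the disjoint union of the [T j] to [S] with components [f j] is
   a closed embedding. *)
Record sum_embedding : Prop := SumEmbedding {
  sum_embedding_continuous : forall j, continuous (f j);
  sum_embedding_inj : forall j, injective (f j);
  sum_embedding_open : forall j (V : set (T j)), open V ->
    exists W : set S, [/\ open W, forall y, W (f j y) <-> V y &
                       forall k y, j <> k -> ~ W (f k y)];
  sum_embedding_closed : forall x, (exists j y, x = f j y) \/
    exists W : set S, [/\ open W, W x & forall j y, ~ W (f j y)] }.

Definition splits (A : set S) (B : forall j, set (T j)) : Prop :=
  forall x, A x <-> exists j, exists2 y, B j y & x = f j y.

Hypothesis fE : sum_embedding.

Lemma splits_mem A B j y : splits A B -> A (f j y) <-> B j y.
Proof.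
move=> AB; split=> [/AB[k [z Bz e]]|By]; last by apply/AB; exists j, y.
(* Applied to the whole of [T j], openness yields a set that contains the image of [f j] and misses
   all other images; hence the index [k] must be [j]. *)
have [W [_ Wj Wk]] := sum_embedding_open fE (@openT (T j)).
have [ejk|/(Wk k z)] := pselect (j = k); last by rewrite -e => -[]; apply/Wj.
by case: _ / ejk z Bz e => z Bz /(sum_embedding_inj fE) ->.
Qed.

(** Continuity and injectivity push limit points forward. Conversely, closedness places a limit
    point of [A] in some image, and an open set meeting only that image forces the nearby points of
    [A] to come from the same [B j]. *)
Lemma splits_limit_point A B :
  splits A B -> splits (limit_point A) (fun j => limit_point (B j)).
Proof.
move=> AB x; split=> [Ax|[j [y By ->]] U Ufy]; last first.
  have [z [zy Bz Uz]] := By _ (sum_embedding_continuous fE Ufy).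
  exists (f j z); split=> //; last by apply/(splits_mem _ AB).
  by apply: contra_neq zy => /(sum_embedding_inj fE).
have [[j [y e]]|[W [oW Wx nW]]] := sum_embedding_closed fE x; last first.
  have [a [_ /AB[j [y _ ->]] /nW[]]] := Ax W (open_nbhs_nbhs (conj oW Wx)).
exists j, y => // U; rewrite nbhsE => -[V [oV Vy] VU].
have [W [oW Wj Wk]] := sum_embedding_open fE oV.
have Wx : W x by rewrite e; apply/Wj.
have [a [ax /AB[k [b Bb ea]] Wa]] := Ax W (open_nbhs_nbhs (conj oW Wx)).
rewrite ea in ax Wa; have [ejk|/(Wk k b)//] := pselect (j = k).
case: _ / ejk b Bb ea ax Wa => b Bb _ ax Wa; exists b; split=> //.
  by apply: contra_neq ax => ->.
exact/VU/Wj.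
Qed.

Lemma splits_isolated A B :
  splits A B -> splits (isolated A) (fun j => isolated (B j)).
Proof.
move=> AB x; have lAB := splits_limit_point AB.
split=> [/isolatedE[/AB[j [y By ->]] nl]|[j [y /isolatedE[By nl] ->]]].
  exists j, y => //; apply/isolatedE; split=> // ly; apply: nl.
  by apply/(splits_mem _ lAB).
apply/isolatedE; split; first by apply/(splits_mem _ AB).
by move/(splits_mem _ lAB).
Qed.

Lemma splits_setI A B C D : splits A B -> (forall j y, C (f j y) <-> D j y) ->
  splits (A `&` C) (fun j => B j `&` D j).
Proof.
move=> AB CD x; split=> [[/AB[j [y By ->]] /CD Dy]|[j [y [By Dy] ->]]].
  by exists j, y.
by split; [apply/(splits_mem _ AB)|apply/CD].
Qed.

End SumEmbedding.

Section SphereDecomposition.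
Context {R : realType} {I : Type} {Gamma : groupType} {Delta : I -> groupType}.
Variable r : forall j, retraction Gamma (Delta j).

Let f j : char_sphere R (Delta j) -> char_sphere R Gamma := pull_ray (r j).
Arguments f : clear implicits.

Definition orthogonal : Prop :=
  forall j k d, j <> k -> r k (rsec (r j) d) = 1%g.

Definition two_nonzero (chi : character R Gamma) : Prop := exists j k,
  [/\ j <> k, pull (rsec (r j)) chi != 0 & pull (rsec (r k)) chi != 0].

Definition exhaustive : Prop := forall chi : nz_character R Gamma,
  (exists j (psi : nz_character R (Delta j)),
     val chi = pull (r j) (val psi)) \/ two_nonzero (val chi).

Lemma orthogonal_pull j k (psi : character R (Delta k)) : orthogonal ->
  j <> k -> pull (rsec (r j)) (pull (r k) psi) = 0.
Proof. by move=> o jk; apply: char_ext => d; rewrite /= o // char1. Qed.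

Lemma section_preimage_pull j V y : section_preimage (r j) V (f j y) <-> V y.
Proof.
have [psi ->] := ray_surj y; rewrite /f pull_rayE.
split=> [/section_preimage_ray[xi]|Vpsi].
  by rewrite pull_rsecK => /val_inj ->.
by apply/section_preimage_ray; exists psi; rewrite ?pull_rsecK.
Qed.

Lemma section_preimage_orthogonal j k V y : orthogonal -> j <> k ->
  ~ section_preimage (r j) V (f k y).
Proof.
have [psi ->] := ray_surj y; rewrite /f pull_rayE => o jk.
case/section_preimage_ray => xi; rewrite orthogonal_pull // => e.
by have := valP xi; rewrite /= -e eqxx.
Qed.

Lemma section_preimageT j (chi : nz_character R Gamma) :
  pull (rsec (r j)) (val chi) != 0 -> section_preimage (r j) setT (ray chi).
Proof.
move=> chi0; apply/section_preimage_ray.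
by exists (exist (fun c : character R (Delta j) => c != 0) _ chi0).
Qed.

Lemma sphere_sum_embedding : orthogonal -> exhaustive -> sum_embedding f.
Proof.
move=> o ex; split.
- by move=> j; exact: pull_ray_continuous.
- by move=> j; exact: pull_ray_inj.
- move=> j V oV; exists (section_preimage (r j) V); split.
  + exact: open_section_preimage.
  + by move=> y; exact: section_preimage_pull.
  + by move=> k y; exact: section_preimage_orthogonal.
- move=> x; have [chi ->] := ray_surj x.
  have [[j [psi e]]|[j [k [jk cj ck]]]] := ex chi.
    left; exists j, (ray psi); rewrite /f pull_rayE; congr ray.
    exact: val_inj.
  (* Being non-zero on both pieces [j] and [k] is an open condition, and no pulled-back character
     satisfies it, since by orthogonality it lives on a single piece. *)
  right; exists (section_preimage (r j) setT `&` section_preimage (r k) setT).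
  split.
  + by apply: openI; apply: open_section_preimage; exact: openT.
  + by split; exact: section_preimageT.
  + move=> l y [sj sk]; have [ejl|jl] := pselect (j = l).
      case: _ / ejl y sj sk => y _ sk.
      exact: (section_preimage_orthogonal o (nesym jk) sk).
    exact: (section_preimage_orthogonal o jl sj).
Qed.

End SphereDecomposition.

Arguments exhaustive R {I Gamma Delta} r.

Section SigmaDecomposition.
Context {R : realType} {I : Type} {Gamma : groupType} {Delta : I -> groupType}.
Variable r : forall j, retraction Gamma (Delta j).

Let f j : char_sphere R (Delta j) -> char_sphere R Gamma := pull_ray (r j).

Definition Sigma_decomposition : Prop := sum_embedding f /\
  splits f (Sigma_c R Gamma) (fun j => Sigma_c R (Delta j)).

(** That the images of the [Sigma_c R (Delta j)] lie in [Sigma_c R Gamma] is [pull_ray_Sigma], valid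
    for every retraction. The opposite inclusion comes from exhaustiveness and the two assumptions
    on Sigma. *)
Lemma Sigma_decompositionI : orthogonal r -> exhaustive R r ->
  (forall j x, BNS_Sigma R (Delta j) x ->
     BNS_Sigma R Gamma (pull_ray (r j) x)) ->
  (forall chi : nz_character R Gamma, two_nonzero r (val chi) ->
     BNS_Sigma R Gamma (ray chi)) ->
  Sigma_decomposition.
Proof.
move=> o ex Sr S2; split; first exact: sphere_sum_embedding.
move=> x; split=> [|[j [y nSy ->]] /pull_ray_Sigma //].
have [chi ->] := ray_surj x => nS.
have [[j [psi e]]|/S2//] := ex chi.
have e' : ray chi = f (ray psi).
  by rewrite /f pull_rayE; congr ray; exact: val_inj.
by exists j, (ray psi) => // /Sr; rewrite -/(f (ray psi)) -e'.
Qed.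

Hypothesis rD : Sigma_decomposition.

Lemma D_Q_splits : splits f (D_Q R Gamma) (fun j => D_Q R (Delta j)).
Proof.
have [fE fS] := rD; rewrite {1}/D_Q setIC.
have -> : (fun j => D_Q R (Delta j)) =
    (fun j => isolated (Sigma_c R (Delta j)) `&` S_Q R (Delta j)).
  by apply: functional_extensionality_dep => j; rewrite setIC.
apply: splits_setI => // [|j y]; last exact: pull_ray_S_Q.
exact: splits_isolated.
Qed.

Lemma L_Q_splits : splits f (L_Q R Gamma) (fun j => L_Q R (Delta j)).
Proof.
have [fE fS] := rD; apply: splits_setI => // [|j y]; last exact: pull_ray_S_Q.
exact/splits_limit_point/D_Q_splits.
Qed.

Lemma L_Sigma_c_S_Q_splits : splits f (L_Sigma_c R Gamma `&` S_Q R Gamma)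
  (fun j => L_Sigma_c R (Delta j) `&` S_Q R (Delta j)).
Proof.
have [fE fS] := rD; apply: splits_setI => // [|j y]; last exact: pull_ray_S_Q.
exact: splits_limit_point.
Qed.

End SigmaDecomposition.

Arguments Sigma_decomposition R {I Gamma Delta} r.

(** * Invariant characters *)

Section Primitive.
Context {R : realType}.

Definition is_primitive (Gamma : groupType) (x : char_sphere R Gamma)
    (chi : character R Gamma) : Prop :=
  (exists2 c : nz_character R Gamma, val c = chi & ray c = x) /\
  range chi = range (fun m : int => m%:~R : R^o).

Lemma is_primitive_ex (Gamma : groupType) (x : char_sphere R Gamma) :
  S_Q R Gamma x -> exists chi, is_primitive x chi.
Proof.
case=> chi [a a0 e] <-.
have na0 : 0 < `|a|^-1 by rewrite invr_gt0 normr_gt0.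
have c0 : `|a|^-1 *: val chi != 0.
  by rewrite scaler_eq0 negb_or gt_eqF ?(valP chi).
exists (`|a|^-1 *: val chi); split.
  exists (exist (fun c : character R Gamma => c != 0) _ c0) => //.
  apply/ray_eqP; exists `|a|; first by rewrite normr_gt0.
  by rewrite /= scalerA divff ?scale1r ?normr_eq0.
(* The sign of [a]: staying on the ray allows division by [|a|] only, so a negative generator [a]
   becomes -1. Multiplication by [e0] permutes the integers, hence the image is still Z. *)
pose e0 : int := if 0 <= a then 1 else -1.
have e0a m : `|a|^-1 * (a *~ m) = (e0 * m)%:~R.
  rewrite -mulrzr mulrA intrM; congr (_ * _); rewrite /e0.
  have [a_ge0|a_lt0] := lerP 0 a; first by rewrite ger0_norm // mulVf.
  by rewrite ltr0_norm // invrN mulNr mulVf.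
have e0e0 : e0 * e0 = 1 by rewrite /e0; case: ifP.
apply/seteqP; split=> [_ [g _ <-]|_ [m _ <-]].
  have [m _ em] : range (fun m : int => a *~ m) (val chi g).
    by rewrite -e; exists g.
  by exists (e0 * m) => //; rewrite -[RHS]/(`|a|^-1 * val chi g) -em e0a.
have [g _ eg] : range (val chi) (a *~ (e0 * m)) by rewrite e; exists (e0 * m).
exists g => //; rewrite -[LHS]/(`|a|^-1 * val chi g) eg e0a.
by rewrite mulrA e0e0 mul1r.
Qed.

(** The ratio [a] of two such representatives and its inverse are both integers, and the only
    positive unit of Z is 1. *)
Lemma is_primitive_uniq (Gamma : groupType) (x : char_sphere R Gamma) chi psi :
  is_primitive x chi -> is_primitive x psi -> chi = psi.
Proof.
move=> [[c ec cx] rc] [[d ed dx] rd].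
have /ray_eqP[a a0] : ray c = ray d by rewrite cx.
rewrite ec ed => ea; suff a1 : a = 1 by rewrite ea a1 scale1r.
have [g _ cg] : range chi 1 by rewrite rc; exists 1.
have [h _ dh] : range psi 1 by rewrite rd; exists 1.
have [m _ em] : range (fun m : int => m%:~R : R^o) (psi g).
  by rewrite -rd; exists g.
have [k _ ek] : range (fun m : int => m%:~R : R^o) (chi h).
  by rewrite -rc; exists h.
have am : a = m%:~R by rewrite em ea -[RHS]/(a * chi g) cg mulr1.
have mk : (m * k)%:~R = 1%:~R :> R.
  by rewrite intrM -am ek -[LHS]/((a *: chi) h) -ea dh.
move/intr_inj in mk; have m0 : 0 < m by rewrite -(ltr0z R) -am.
have : (m %| 1)%Z by apply/dvdzP; exists k; rewrite mulrC.
by rewrite dvdz1 => /eqP m1; rewrite am -(gtz0_abs m0) m1.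
Qed.

Lemma is_primitive_pull (Gamma Delta : groupType) (r : retraction Gamma Delta)
    (x : char_sphere R Delta) chi :
  is_primitive x chi -> is_primitive (pull_ray r x) (pull r chi).
Proof.
move=> [[c <- <-] rc]; split; first by exists (pull_nz r c); rewrite ?pull_rayE.
rewrite -rc; apply/seteqP; split=> [_ [g _ <-]|_ [d _ <-]].
  by exists (r g).
by exists (rsec r d) => //=; rewrite rsecK.
Qed.

(** The value 0 is a default, taken at points that are not rational. *)
Definition primitive (Gamma : groupType) (x : char_sphere R Gamma) :
  character R Gamma := xget 0 (is_primitive x).

Lemma primitiveP (Gamma : groupType) (x : char_sphere R Gamma) :
  S_Q R Gamma x -> is_primitive x (primitive x).
Proof. by move=> /is_primitive_ex; exact: xgetPex. Qed.

Lemma primitive_pull (Gamma Delta : groupType) (r : retraction Gamma Delta)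
    (x : char_sphere R Delta) : S_Q R Delta x ->
  primitive (pull_ray r x) = pull r (primitive x).
Proof.
move=> Sx; apply: is_primitive_uniq; last exact/is_primitive_pull/primitiveP.
exact/primitiveP/pull_ray_S_Q.
Qed.

End Primitive.

(** For [g] with [0 < chi g], the constant value of [chi] on the class of [g ^+ n] is [chi g *+ n],
    so the powers of [g] lie in pairwise distinct classes. *)
Lemma invariant_character_infinite (R : realType) (Gamma : groupType)
    (phi : {multiplicative Gamma -> Gamma}) (chi : character R Gamma) :
  chi != 0 -> pull phi chi = chi -> infinite_set (twisted_classes phi).
Proof.
move=> /char_neq0P[g g0] chi_phi.
have phiE h : chi (phi h) = chi h by rewrite -[in RHS]chi_phi.
pose cls (n : nat) : set Gamma := [set y | twisted_conjugate phi (g ^+ n)%g y].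
have cls_inj : injective cls.
  move=> m n /(congr1 (fun A : set Gamma => A (g ^+ n)%g)); rewrite /cls /=.
  have -> : twisted_conjugate phi (g ^+ n)%g (g ^+ n)%g = True.
    by apply/propT; exists 1%g; rewrite invg1 multiplicative1 mulg1 mul1g.
  move=> e.
  have [h /(congr1 chi)] : twisted_conjugate phi (g ^+ m)%g (g ^+ n)%g.
    by rewrite e.
  rewrite !charM phiE charV addrAC addrN add0r !charX => /eqP.
  by rewrite eq_le !ler_pMn2l // -eqn_leq => /eqP.
move=> /(finite_preimage (f := cls) (in2W cls_inj)).
suff -> : cls @^-1` twisted_classes phi = setT by exact: infinite_nat.
by apply/seteqP; split=> // n _; exists (g ^+ n)%g.
Qed.

Section Automorphism.
Context {R : realType} {Gamma : groupType}.

Lemma bijective_retraction (phi : {multiplicative Gamma -> Gamma}) :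
  bijective phi -> exists2 r : retraction Gamma Gamma,
    rproj r = phi & cancel r (rsec r).
Proof.
case=> g fK gK.
pose gM := isMultiplicative.Build Gamma Gamma g (can2_gmulfM fK gK).
pose psi : {multiplicative Gamma -> Gamma} := HB.pack g gM.
by exists (@Retraction _ _ phi psi gK).
Qed.

(** An automorphism is a decomposition with a single piece: orthogonality and [two_nonzero] concern
    distinct indices, of which there are none. Results on decompositions thus show that
    automorphisms preserve the sets in question. *)
Lemma automorphism_decomposition (r : retraction Gamma Gamma) :
  cancel r (rsec r) -> Sigma_decomposition R (fun _ : unit => r).
Proof.
move=> rK; pose r' := @Retraction _ _ (rsec r) r rK.
apply: Sigma_decompositionI => [[] []//|chi|_ x|chi [[] [[] []//]]].
  left; exists tt, (pull_nz r' chi).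
  by apply: char_ext => g; rewrite /= rK.
have [psi ->] := ray_surj x; rewrite pull_rayE.
(* Passing from [Sigma] of the target back to the source uses the inverse automorphism as the
   retraction. *)
apply: (retract_Sigma (r := r')).
by rewrite /= (pull_rsecK r).
Qed.

End Automorphism.

Lemma ler_sum_mem (R : numDomainType) (T : eqType) (s : seq T) (F : T -> R) x :
  x \in s -> {in s, forall y, 0 <= F y} -> F x <= \sum_(y <- s) F y.
Proof.
move=> xs F0; rewrite (big_rem _ xs) /= lerDl big_seq sumr_ge0 // => y /mem_rem.
exact: F0.
Qed.

(** The splitting assumption on [K] ranges over all decompositions because it is used twice: for the
    given [r], and for an automorphism, where it says that [K Gamma] is invariant. *)
Lemma R_infinity_of_decomposition (R : realType) (I : finType)
    (Gamma : groupType) (Delta : I -> groupType)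
    (r : forall j, retraction Gamma (Delta j)) (i : I)
    (K : forall Gamma : groupType, set (char_sphere R Gamma)) :
  (forall Gamma, K Gamma `<=` S_Q R Gamma) ->
  (forall (J : Type) (Gamma : groupType) (Delta : J -> groupType)
      (r : forall j, retraction Gamma (Delta j)), Sigma_decomposition R r ->
    splits (fun j => pull_ray (r j)) (K Gamma) (fun j => K (Delta j))) ->
  orthogonal r -> Sigma_decomposition R r ->
  K (Delta i) !=set0 -> in_open_hemisphere (K (Delta i)) ->
  (forall j, finite_set (K (Delta j))) ->
  R_infinity Gamma.
Proof.
move=> KQ Ksplit ro rD [x0 Kx0] [H [l _ HE] KH] Kfin phi phi_bij.
have K_r := Ksplit _ _ _ _ rD.
have K_fin : finite_set (K Gamma).
  have -> : K Gamma = \bigcup_j (pull_ray (r j) @` K (Delta j)).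
    apply/seteqP; split=> [x /K_r[j [y Ky ->]]|x [j _ [y Ky <-]]].
      by exists j => //; exists y.
    by apply/K_r; exists j, y.
  by apply: bigcup_finite => [|j _]; [exact: finite_finset|exact: finite_image].
have [s sphi sK] := bijective_retraction phi_bij.
have sD := automorphism_decomposition (R := R) sK.
have K_s x : K Gamma (pull_ray s x) <-> K Gamma x.
  exact: (@splits_mem _ _ _ _ sD.1 _ _ tt x (Ksplit _ _ _ _ sD)).
have [t [t_uniq tK]] : exists t : seq (char_sphere R Gamma),
    uniq t /\ forall x, (x \in t) <-> K Gamma x.
  have /finite_seqP[t ->] := K_fin; exists (undup t).
  by split=> [|x]; rewrite ?undup_uniq ?mem_undup.
pose chi : character R Gamma := \sum_(x <- t) primitive x.
apply: (@invariant_character_infinite R _ _ chi); last first.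
  rewrite -sphi raddf_sum /=.
  (* Pulling back along the automorphism carries primitive representatives to primitive
     representatives, so it merely permutes the summands. *)
  transitivity (\sum_(x <- map (pull_ray s) t) primitive x).
    rewrite big_map; apply: eq_big_seq => x /tK Kx.
    by rewrite primitive_pull //; exact: KQ.
  apply/perm_big/uniq_perm => // [|x].
    by rewrite map_inj_uniq //; exact: pull_ray_inj.
  apply/mapP/idP => [[y /tK/K_s Ky ->]|]; last first.
    by move=> /tK/(Ksplit _ _ _ _ sD)[_ [y /tK yt ->]]; exists y.
    exact/tK.
have K_pos x : K (Delta i) x -> 0 < l (primitive x).
  move=> Kx; have := KH x Kx; rewrite HE => -[psi /= lpsi ex].
  have [[c <- cx] _] := primitiveP (KQ _ _ Kx).
  have /ray_eqP[a a0 ->] : ray psi = ray c by rewrite ex cx.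
  by rewrite linearZ /= mulr_gt0.
(* Restricted to the piece [i], a summand coming from another piece vanishes, and one coming from
   [K (Delta i)] is positive under [l]. *)
have K_term x : K Gamma x -> 0 <= l (pull (rsec (r i)) (primitive x)).
  move=> /K_r[j [y Ky ->]]; rewrite primitive_pull; last exact: KQ.
  have [eij|ij] := pselect (i = j).
    by case: _ / eij y Ky => y Ky; rewrite pull_rsecK ltW // K_pos.
  by rewrite orthogonal_pull // raddf0.
have x0t : pull_ray (r i) x0 \in t by apply/tK/K_r; exists i, x0.
(* If [chi] were 0, the positive term at [x0] would be bounded by a sum of non-negative terms equal
   to 0. *)
apply: contraTneq (K_pos _ Kx0) => chi0; rewrite -leNgt.
have -> : primitive x0 = pull (rsec (r i)) (primitive (pull_ray (r i) x0)).
  by rewrite primitive_pull ?pull_rsecK //; exact: KQ.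
have <- : l (pull (rsec (r i)) chi) = 0 by rewrite chi0 !raddf0.
pose F x := l (pull (rsec (r i)) (primitive x)).
by rewrite !raddf_sum; apply: (ler_sum_mem (F := F)) => // x /tK; exact: K_term.
Qed.

(** * Direct products *)

Section ProductRetraction.
Context {I : eqType} (G : I -> groupType).

Definition prodg_proj (j : I) (g : prod_group G) : G j := g j.

Fact prodg_projM j : {morph prodg_proj j : g h / (g * h)%g}.
Proof. by []. Qed.

HB.instance Definition _ j :=
  isMultiplicative.Build (prod_group G) (G j) (prodg_proj j) (prodg_projM j).

Definition prodg_inj (j : I) (x : G j) : prod_group G :=
  dfwith (fun k => 1%g : G k) j x.
Arguments prodg_inj {j} x.

Lemma prodg_inj_in j x : prodg_inj x j = x.
Proof. exact: dfwithin. Qed.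

Lemma prodg_inj_out j k (x : G j) : j != k -> prodg_inj x k = 1%g.
Proof. exact: dfwithout. Qed.

Lemma prodg_ext (g h : prod_group G) : (forall j, g j = h j) -> g = h.
Proof. exact: functional_extensionality_dep. Qed.

Lemma prodg_mulE (g h : prod_group G) j : (g * h)%g j = (g j * h j)%g.
Proof. by []. Qed.

Fact prodg_injM j : {morph @prodg_inj j : x y / (x * y)%g}.
Proof.
move=> x y; apply: prodg_ext => k; rewrite prodg_mulE.
have [<-|jk] := eqVneq j k; first by rewrite !prodg_inj_in.
by rewrite !prodg_inj_out // mulg1.
Qed.

HB.instance Definition _ j :=
  isMultiplicative.Build (G j) (prod_group G) (@prodg_inj j) (@prodg_injM j).

Definition prodg_retraction j : retraction (prod_group G) (G j) :=
  @Retraction _ _ (prodg_proj j) (@prodg_inj j) (@prodg_inj_in j).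

Lemma prodg_inj_commute j k (x : G j) (y : G k) :
  j != k -> commute (prodg_inj x) (prodg_inj y).
Proof.
move=> jk; apply: prodg_ext => l; rewrite !prodg_mulE.
have [<-|jl] := eqVneq j l.
  by rewrite (@prodg_inj_out k j) 1?eq_sym // mulg1 mul1g.
by rewrite (prodg_inj_out _ jl) mulg1 mul1g.
Qed.

Lemma prodg_orthogonal : orthogonal prodg_retraction.
Proof. by move=> j k d /eqP; exact: prodg_inj_out. Qed.

End ProductRetraction.

(** * Sigma of a direct product *)

Arguments prodg_inj {I G j} x.

Section ProductSigma.
Context {R : realType} {I : finType} (G : I -> groupType).
Local Notation Gamma := (prod_group G).
Local Notation r := (prodg_retraction G).

(** As [I] is finite, an element is the product of its components, multiplied together along
    [enum I]. *)
Lemma prodg_ind (P : Gamma -> Prop) : P 1%g ->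
  (forall g h, P g -> P h -> P (g * h)%g) ->
  forall g, (forall j, P (prodg_inj (g j))) -> P g.
Proof.
move=> P1 PM g Pg.
pose trunc (s : seq I) : Gamma := fun k => if k \in s then g k else 1%g.
have -> : g = trunc (enum I) by apply: prodg_ext => j; rewrite /trunc mem_enum.
elim: (enum I) (enum_uniq I) => [_|j s IHs /= /andP[js us]].
  by rewrite (_ : trunc [::] = 1%g) //; exact: prodg_ext.
rewrite (_ : trunc (j :: s) = prodg_inj (g j) * trunc s)%g.
  by apply: PM => //; exact: IHs.
apply: prodg_ext => k; rewrite prodg_mulE /trunc inE.
have [->|kj] := eqVneq k j; first by rewrite prodg_inj_in (negPf js) mulg1.
by rewrite prodg_inj_out 1?eq_sym // mul1g.
Qed.

(** By [prodg_ind], a character is determined by its restrictions to the factors. One of them is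
    non-zero; if it is the only one, the character is its pullback. *)
Lemma prodg_exhaustive : exhaustive R r.
Proof.
move=> chi.
have pull0 k : ~ pull (rsec (r k)) (val chi) != 0 ->
    forall x : G k, val chi (prodg_inj x) = 0.
  move=> /negP/negPn/eqP c0 x.
  by rewrite -[LHS]/(pull (rsec (r k)) (val chi) x) c0.
have [j cj] : exists j, pull (rsec (r j)) (val chi) != 0.
  apply: contrapT => /forallNP c0; have /eqP := valP chi; apply.
  apply: char_ext => g.
  apply: (prodg_ind (P := fun g => val chi g = 0)) => [|h k eh ek|j].
  - by rewrite char1.
  - by rewrite charM eh ek addr0.
  - exact: pull0.
have [[k [jk ck]]|/forallNP c0] :=
    pselect (exists k, j <> k /\ pull (rsec (r k)) (val chi) != 0).
  by right; exists j, k.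
left; exists j, (exist (fun c : character R (G j) => c != 0) _ cj).
apply: char_ext => g.
pose P g := val chi g = val chi (prodg_inj (g j)).
apply: (prodg_ind (P := P)) => [|h h' eh eh'|k]; rewrite /P.
- by rewrite multiplicative1.
- by rewrite prodg_mulE gmulfM !charM eh eh'.
- have [<-|/eqP jk] := eqVneq j k; first by rewrite prodg_inj_in.
  rewrite prodg_inj_out; last exact/eqP/nesym.
  by rewrite multiplicative1 char1 pull0 // => ck; apply: (c0 k).
Qed.

(** Each of these generators lies in a single factor, as the commutation arguments require. *)
Definition component_gens (X : seq Gamma) : seq Gamma :=
  [seq prodg_inj (x j) | x <- X, j <- enum I].

Lemma component_gensP X y : reflect (exists x j, x \in X /\ y = prodg_inj (x j))
  (y \in component_gens X).
Proof.
apply: (iffP allpairsP) => [[[x j] /= [xX _ ->]]|[x [j [xX ->]]]].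
  by exists x, j.
by exists (x, j); rewrite mem_enum.
Qed.

Lemma generates_components X Y : generates X ->
  {subset component_gens X <= Y} -> generates Y.
Proof.
move=> gX XY H HH YH g.
apply: (gX H HH) => x xX; apply: (prodg_ind (P := fun g => g \in H)).
- by case: HH.
- by move=> h k; exact: group_closedM.
- by move=> j; apply/YH/XY/component_gensP; exists x, j.
Qed.

(** With [a] and [b] in different factors, every element of a single factor commutes with one of
    them, so the criterion for commuting elements applies once both are added to the generators. *)
Lemma two_nonzero_Sigma (chi : nz_character R Gamma) :
  finitely_generated Gamma -> two_nonzero r (val chi) ->
  BNS_Sigma R Gamma (ray chi).
Proof.
move=> [X gX] [j [k [/eqP jk /char_neq0P[a a0] /char_neq0P[b b0]]]].
apply/BNS_Sigma_ray; exists [:: prodg_inj a, prodg_inj b & component_gens X].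
  by apply: generates_components gX _ => x xX; rewrite !inE xX !orbT.
apply: (commuting_half_space_connected (t := prodg_inj a) (s := prodg_inj b)).
- by apply: generates_components gX _ => x xX; rewrite !inE xX !orbT.
- by rewrite !inE eqxx.
- by rewrite !inE eqxx orbT.
- exact: prodg_inj_commute.
- exact: a0.
- exact: b0.
- have com y i (x : G i) : y = prodg_inj x ->
    commute y (prodg_inj a) \/ commute y (prodg_inj b).
    move=> ->; have [ij|ij] := eqVneq i j; last first.
      by left; exact: prodg_inj_commute.
    by right; apply: prodg_inj_commute; rewrite ij.
  move=> x; rewrite !inE => /or3P[/eqP|/eqP|]; [exact: com|exact: com|].
  by case/component_gensP => y [i [_]]; exact: com.
Qed.

(** The identity is joined to [g] in two stages: a path of the factor [j] is copied to reach the
    component [g j], then the other components are multiplied in, which leaves the character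
    unchanged. *)
Lemma prodg_pull_Sigma j (x : char_sphere R (G j)) : finitely_generated Gamma ->
  BNS_Sigma R (G j) x -> BNS_Sigma R Gamma (pull_ray (r j) x).
Proof.
have [psi ->] := ray_surj x.
move=> [Y gY] /BNS_Sigma_ray[X gX hX]; rewrite pull_rayE; apply/BNS_Sigma_ray.
pose Z : seq Gamma := map (@prodg_inj _ G j) X ++ component_gens Y.
have gZ : generates Z.
  by apply: generates_components gY _ => y yY; rewrite mem_cat yY orbT.
exists Z => //; pose chi : character R Gamma := pull (r j) (val psi).
suff : half_space_connected Z chi by [].
have chiE g : chi g = val psi (g j) by [].
(* [away h] is [h] with its component at [j] replaced by 1; the map [away] is multiplicative. *)
pose away (h : Gamma) : Gamma := (h * prodg_inj (h j)^-1)%g.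
have awayM g h : away (g * h)%g = (away g * away h)%g.
  apply: prodg_ext => k; rewrite /away !prodg_mulE.
  have [<-|jk] := eqVneq j k; first by rewrite !prodg_inj_in !mulgV mulg1.
  by rewrite !prodg_inj_out // !mulg1.
have away_j g : away g j = 1%g by rewrite /away prodg_mulE prodg_inj_in mulgV.
have away_in (x' : G j) : away (prodg_inj x') = 1%g.
  by rewrite /away prodg_inj_in multiplicativeV mulgV.
have away1 : away 1%g = 1%g by rewrite /away invg1 multiplicative1 mulg1.
have chi_away g h : chi (g * away h)%g = chi g.
  by rewrite !chiE prodg_mulE away_j mulg1.
have link_away : forall h g, 0 <= chi g -> linked Z chi g (g * away h)%g.
  apply: (generates_ind gZ) => [|h k IHh IHk|h IHh|h hZ] g g0.
  - by rewrite away1 mulg1; exact: linked_refl.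
  - rewrite awayM mulgA; apply: linked_trans (IHh g g0) _.
    by apply: IHk; rewrite chi_away.
  - apply: linked_sym; have := IHh (g * away h^-1)%g.
    by rewrite -mulgA -awayM mulVg away1 mulg1; apply; rewrite chi_away.
  (* A generator in the factor [j] is killed by [away]; one in another factor is fixed and gives a
     single edge along which [chi] is constant. *)
  - have [k [x' ex]] : exists k (x' : G k), h = prodg_inj x'.
      move: hZ; rewrite mem_cat => /orP[/mapP[x' _ ->]|]; first by exists j, x'.
      by case/component_gensP => y [k [_ ->]]; exists k, (y k).
    have [ejk|/eqP jk] := pselect (j = k).
      case: _ / ejk x' ex => x' ->.
      by rewrite away_in mulg1; exact: linked_refl.
    have -> : away h = h.
      by rewrite /away ex prodg_inj_out 1?eq_sym // invg1 multiplicative1 mulg1.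
    apply: linked_step => //.
    by rewrite chiE prodg_mulE ex prodg_inj_out 1?eq_sym // mulg1 -chiE.
apply: linked1_connected => g g0.
have eg : (prodg_inj (g j) * away g)%g = g.
  apply: prodg_ext => k; rewrite /away !prodg_mulE.
  have [<-|jk] := eqVneq j k; first by rewrite !prodg_inj_in mulgV mulg1.
  by rewrite !prodg_inj_out // mul1g mulg1.
rewrite -eg; apply: (@linked_trans _ _ Z chi (prodg_inj (g j))); last first.
  by apply: link_away; rewrite chiE prodg_inj_in.
have inj_ge0 (x' : G j) : (0 <= chi (prodg_inj x')) = (0 <= val psi x').
  by rewrite chiE prodg_inj_in.
split; first by rewrite char1.
have := hX 1%g (g j); rewrite char1 => /(_ (lexx _) g0)[q [pq lq q0]].
exists (map prodg_inj q); split.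
- rewrite -[1%g](multiplicative1 (@prodg_inj _ G j)) path_map.
  apply: sub_path pq => x1 x2 /hasP[y yX e]; apply/hasP; exists (prodg_inj y).
    by rewrite mem_cat map_f.
  by case/orP: e => /eqP ->; rewrite gmulfM eqxx ?orbT.
- by rewrite -[1%g](multiplicative1 (@prodg_inj _ G j)) last_map lq.
- by rewrite all_map; apply: sub_all q0 => y; rewrite /= inj_ge0.
Qed.

Lemma prodg_decomposition : finitely_generated Gamma -> Sigma_decomposition R r.
Proof.
move=> fg; apply: Sigma_decompositionI.
- exact: prodg_orthogonal.
- exact: prodg_exhaustive.
- by move=> j x; exact: prodg_pull_Sigma.
- by move=> chi; exact: two_nonzero_Sigma.
Qed.

End ProductSigma.

Theorem theorem5p2 (R : realType) (n : nat) (G : 'I_n.+1 -> groupType)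
    (G_fg : finitely_generated (prod_group G))
    (G_hyp :
      [\/ [/\ D_Q R (G ord0) !=set0,
              finite_set (D_Q R (G ord0)),
              in_open_hemisphere (D_Q R (G ord0)) &
              forall j : 'I_n.+1, j != ord0 -> finite_set (D_Q R (G j))],
          [/\ L_Q R (G ord0) !=set0,
              finite_set (L_Q R (G ord0)),
              in_open_hemisphere (L_Q R (G ord0)) &
              forall j : 'I_n.+1, j != ord0 -> finite_set (L_Q R (G j))] |
          [/\ L_Sigma_c R (G ord0) `&` S_Q R (G ord0) !=set0,
              finite_set (L_Sigma_c R (G ord0) `&` S_Q R (G ord0)),
              in_open_hemisphere (L_Sigma_c R (G ord0) `&` S_Q R (G ord0)) &
              forall j : 'I_n.+1, j != ord0 ->
                finite_set (L_Sigma_c R (G j) `&` S_Q R (G j))]]) :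
  R_infinity (prod_group G).
Proof.
(* The three alternatives are one statement for three choices of [K], each contained in the rational
   points and compatible with decompositions. *)
have main (K : forall Gamma : groupType, set (char_sphere R Gamma)) :
    (forall Gamma, K Gamma `<=` S_Q R Gamma) ->
    (forall (J : Type) (Gamma : groupType) (Delta : J -> groupType)
      (r : forall j, retraction Gamma (Delta j)), Sigma_decomposition R r ->
      splits (fun j => pull_ray (r j)) (K Gamma) (fun j => K (Delta j))) ->
    [/\ K (G ord0) !=set0, finite_set (K (G ord0)),
        in_open_hemisphere (K (G ord0)) &
        forall j, j != ord0 -> finite_set (K (G j))] ->
    R_infinity (prod_group G).
  move=> KQ Ksplit [K0 Kfin0 Khemi Kfin].
  apply: (R_infinity_of_decomposition KQ Ksplit (prodg_orthogonal (G := G))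
    (prodg_decomposition (R := R) G_fg) K0 Khemi) => j.
  by have [->//|/Kfin] := eqVneq j ord0.
case: G_hyp; [apply: (main (D_Q R))|apply: (main (L_Q R))|
  apply: (main (fun Gamma => L_Sigma_c R Gamma `&` S_Q R Gamma))].
- by move=> Gamma x [].
- by move=> J Gamma Delta r; exact: D_Q_splits.
- by move=> Gamma x [].
- by move=> J Gamma Delta r; exact: L_Q_splits.
- by move=> Gamma x [].
- by move=> J Gamma Delta r; exact: L_Sigma_c_S_Q_splits.
Qed.
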